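(* For every finite connected simplicial graph $\Gamma$ of diameter at least $3$, the minimum positive asymptotic translation length for the action of $A(\Gamma)$ on $\Gamma^e$ is at most $2$; that is, there is an element $g\in A(\Gamma)$ with $0<\tau(g)\le 2$.
   Context: For a finite connected simplicial graph $\Gamma$, $A(\Gamma)=\langle v\in V(\Gamma)\mid [u,v]=1 \text{ for all } \{u,v\}\in E(\Gamma)\rangle$ is its right-angled Artin group. For $x,h\in A(\Gamma)$ write $x^h=h^{-1}xh$. The extension graph $\Gamma^e$ is the simplicial graph with vertex set $\{v^g\mid v\in V(\Gamma), g\in A(\Gamma)\}\subset A(\Gamma)$, where two distinct vertices are joined by an edge exactly when they commute in $A(\Gamma)$. It carries the edge metric $d_{\Gamma^e}$. $A(\Gamma)$ acts on $\Gamma^e$ on the right by conjugation, $x\mapsto x^g$. The asymptotic translation length of $g$ is $\tau(g)=\lim_{n\to\infty} d_{\Gamma^e}(x,x^{g^n})/n$ (independent of the vertex $x$). The diameter of $\Gamma$ is with respect to its edge metric. *)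

(* Defs.v *)
From HB Require Import structures.
From mathcomp Require Import all_boot all_order all_algebra.
From mathcomp Require Import all_classical all_reals all_analysis.
Import Order.TTheory GRing.Theory Num.Theory.
Import numFieldNormedType.Exports.

Set Implicit Arguments.
Unset Strict Implicit.
Unset Printing Implicit Defensive.

Local Open Scope quotient_scope.

Section Presentation.
Variable X : choiceType.

(* The letter [(x, true)] stands for x and [(x, false)] for x^-1. *)
Definition word := seq (X * bool).

Definition winv (w : word) : word := rev [seq (a.1, ~~ a.2) | a <- w].

Lemma winvK : involutive winv.
Proof.
move=> w; rewrite /winv map_rev revK -map_comp -[RHS]map_id.
by apply: eq_map => -[x b] /=; rewrite negbK.
Qed.

Lemma winv_cat u v : winv (u ++ v) = winv v ++ winv u.
Proof. by rewrite /winv map_cat rev_cat. Qed.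

Variable rels : word -> Prop.

(* The smallest congruence on words making each letter inverse to its opposite
   and each relator trivial. *)
Inductive weq : word -> word -> Prop :=
| weq_refl w : weq w w
| weq_sym u v : weq u v -> weq v u
| weq_trans u v w : weq u v -> weq v w -> weq u w
| weq_cat u u' v v' : weq u u' -> weq v v' -> weq (u ++ v) (u' ++ v')
| weq_cancel x b : weq [:: (x, b); (x, ~~ b)] [::]
| weq_rel r : rels r -> weq r [::].

Lemma weq_catV w : weq (w ++ winv w) [::].
Proof.
elim: w => [|[x b] w IHw]; first exact: weq_refl.
have -> : ((x, b) :: w) ++ winv ((x, b) :: w)
        = [:: (x, b)] ++ ((w ++ winv w) ++ [:: (x, ~~ b)]).
  by rewrite -[(x, b) :: w]cat1s winv_cat -!catA.
apply: weq_trans (weq_cancel x b).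
rewrite -[[:: (x, b); (x, ~~ b)]]cat1s; apply: weq_cat (weq_refl _) _.
by rewrite -[X in weq _ X]cat0s; apply: weq_cat (weq_refl _).
Qed.

Lemma weq_winv u v : weq u v -> weq (winv u) (winv v).
Proof.
elim=> {u v} [w|u v _|u v w _ uv _ vw|u u' v v' _ uu' _ vv'|x b|r rr].
- exact: weq_refl.
- exact: weq_sym.
- exact: weq_trans uv vw.
- by rewrite !winv_cat; apply: weq_cat.
- rewrite /winv /rev /= negbK; exact: weq_cancel.
- apply: weq_trans (weq_catV r).
  rewrite -[X in weq X _]cat0s.
  by apply: weq_cat (weq_refl _); apply/weq_sym/weq_rel.
Qed.

Definition weqb : rel word := fun u v => `[< weq u v >].

Lemma weqb_refl : reflexive weqb.
Proof. by move=> w; apply/asboolP/weq_refl. Qed.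

Lemma weqb_sym : symmetric weqb.
Proof. by move=> u v; apply/asboolP/asboolP; apply: weq_sym. Qed.

Lemma weqb_trans : transitive weqb.
Proof.
by move=> v u w /asboolP uv /asboolP vw; apply/asboolP; apply: weq_trans uv vw.
Qed.

Canonical weqb_equiv := EquivRel weqb weqb_refl weqb_sym weqb_trans.

Definition presented : Type := {eq_quot weqb}.

HB.instance Definition _ := Choice.on presented.
HB.instance Definition _ := Quotient.on presented.

Definition word_class (w : word) : presented := \pi_presented w.

Lemma word_classP u v : word_class u = word_class v <-> weq u v.
Proof.
split=> [|uv].
  by rewrite /word_class; move/(@eqmodP _ weqb_equiv)/asboolP.
by apply/(@eqmodP _ weqb_equiv)/asboolP.
Qed.

Lemma word_class_repr (x : presented) : word_class (repr x) = x.
Proof. exact: reprK. Qed.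

Lemma weq_repr w : weq (repr (word_class w)) w.
Proof. by apply/word_classP; rewrite word_class_repr. Qed.

Definition presented_one : presented := word_class [::].
Definition presented_mul (x y : presented) : presented :=
  word_class (repr x ++ repr y).
Definition presented_inv (x : presented) : presented :=
  word_class (winv (repr x)).

Lemma presented_mulE u v :
  presented_mul (word_class u) (word_class v) = word_class (u ++ v).
Proof. by apply/word_classP; apply: weq_cat; apply: weq_repr. Qed.

Lemma presented_invE u : presented_inv (word_class u) = word_class (winv u).
Proof. by apply/word_classP/weq_winv/weq_repr. Qed.

Lemma presented_mulA : associative presented_mul.
Proof.
move=> x y z; rewrite -[x]word_class_repr -[y]word_class_repr.
by rewrite -[z]word_class_repr !presented_mulE catA.
Qed.

Lemma presented_mul1 : left_id presented_one presented_mul.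
Proof. by move=> x; rewrite -[x]word_class_repr presented_mulE. Qed.

Lemma presented_mulr1 : right_id presented_one presented_mul.
Proof. by move=> x; rewrite -[x]word_class_repr presented_mulE cats0. Qed.

Lemma presented_mulV : right_inverse presented_one presented_inv presented_mul.
Proof.
move=> x; rewrite -[x]word_class_repr presented_invE presented_mulE.
exact/word_classP/weq_catV.
Qed.

Lemma presented_mulVl : left_inverse presented_one presented_inv presented_mul.
Proof.
move=> x; rewrite -[x]word_class_repr presented_invE presented_mulE.
by apply/word_classP; rewrite -{2}[repr x]winvK; apply: weq_catV.
Qed.

HB.instance Definition _ := isGroup.Build presented
  presented_mulA presented_mul1 presented_mulr1 presented_mulVl presented_mulV.

Definition pgen (x : X) : presented := word_class [:: (x, true)].

End Presentation.

Definition walk_of_length (V : eqType) (E : rel V) (x y : V) (n : nat) : Prop :=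
  exists s : seq V, [/\ size s = n, path E x s & last x s = y].

(* The least length of a walk from x to y; it takes the value 0 if there is no
   such walk, which does not occur in a connected graph. *)
Definition gdist (V : eqType) (E : rel V) (x y : V) : nat :=
  if pselect (exists n, `[< walk_of_length E x y n >]) is left ex_walk
  then ex_minn ex_walk else 0.

Definition connected_graph (T : finType) (e : rel T) : Prop :=
  forall x y : T, connect e x y.

Definition diameter (T : finType) (e : rel T) : nat :=
  \max_(x : T) \max_(y : T) gdist e x y.

Section RAAG.
Variables (T : finType) (e : rel T).

(* The words [u, v] = u^-1 v^-1 u v for {u, v} an edge. *)
Definition raag_rel (r : word T) : Prop :=
  exists u v : T, e u v /\ r = [:: (u, false); (v, false); (u, true); (v, true)].

Definition raag : groupType := presented raag_rel.

Definition raag_gen (v : T) : raag := pgen raag_rel v.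

Local Open Scope group_scope.

Definition is_ext_vertex : pred raag :=
  fun x => `[< exists (v : T) (g : raag), x = raag_gen v ^ g >].

Definition ext_vertex : Type := {x : raag | is_ext_vertex x}.

HB.instance Definition _ := Choice.on ext_vertex.

Definition ext_edge : rel ext_vertex :=
  fun x y => (x != y) && (val x * val y == val y * val x).

Lemma ext_act_subproof (x : ext_vertex) (g : raag) : is_ext_vertex (val x ^ g).
Proof.
case: x => x /= /asboolP [v [h ->]]; apply/asboolP; exists v, (h * g).
by rewrite conjgM.
Qed.

Definition ext_act (x : ext_vertex) (g : raag) : ext_vertex :=
  exist _ (val x ^ g) (ext_act_subproof x g).

Local Open Scope ring_scope.
Local Open Scope classical_set_scope.

(* The limit is required to exist, with value l, for every base vertex x. The
   term of index 0 is 0 / 0 = 0. *)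
Definition translation_length (R : realType) (g : raag) (l : R) : Prop :=
  forall x : ext_vertex,
    (fun n : nat => (gdist ext_edge x (ext_act x (g ^+ n)%g))%:R / n%:R : R)
      @ \oo --> l.

End RAAG.

(* Main.v *)
(* Choose a geodesic a, u, w, b of the graph and g = ab. Since a fixes u and b
   fixes w in the extension graph, u and u^g are joined by the path u, w, u^b,
   so d(u, u^(g^n)) <= 2n.
   For the converse, retract the group onto the free group F on a and b. As a
   and b have no common neighbour, each star meets {a, b} in at most one vertex,
   so the centralizer of a vertex v maps into a subgroup S_v of <a> or of <b>.
   When v^h commutes with w, the image of h lies in S_v S_w; a path of length m
   from v^h to v^k thus writes the image of h k^-1 as a product of m + O(1)
   syllables, while g^-n has syllable length 2n in F. *)

Require Import Defs.
From mathcomp Require Import all_boot all_order all_algebra.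
From mathcomp Require Import all_classical all_reals all_analysis.
Import Order.TTheory GRing.Theory Num.Theory.
Import numFieldNormedType.Exports.
Local Open Scope ring_scope.

Set Implicit Arguments.
Unset Strict Implicit.
Unset Printing Implicit Defensive.

(** * Words, generators and retractions onto sets of vertices *)

Section Presentation.
Variables (T : finType) (e : rel T).
Local Open Scope group_scope.

Local Notation A := (raag e).
Local Notation gen := (raag_gen e).
Local Notation weq := (weq (raag_rel e)).

Definition raag_class (w : word T) : A := word_class (raag_rel e) w.

Lemma raag_classP u v : raag_class u = raag_class v <-> weq u v.
Proof. exact: word_classP. Qed.

Lemma raag_class_repr (x : A) : raag_class (repr x) = x.
Proof. exact: word_class_repr. Qed.

Lemma raag_class_cat u v : raag_class (u ++ v) = raag_class u * raag_class v.
Proof. by symmetry; exact: presented_mulE. Qed.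

Lemma raag_class_nil : raag_class [::] = 1.
Proof. by []. Qed.

Lemma raag_class_cons l u :
  raag_class (l :: u) = raag_class [:: l] * raag_class u.
Proof. exact: (raag_class_cat [:: l]). Qed.

Lemma raag_class_winv u : raag_class (winv u) = (raag_class u)^-1.
Proof. by symmetry; exact: presented_invE. Qed.

Lemma raag_class_letter v b :
  raag_class [:: (v, b)] = if b then gen v else (gen v)^-1.
Proof. by case: b => //; rewrite -raag_class_winv. Qed.

Lemma raag_gen_commute u v : e u v -> commute (gen u) (gen v).
Proof.
move=> euv.
have : raag_class [:: (u, false); (v, false); (u, true); (v, true)] = 1.
  by rewrite -raag_class_nil; apply/raag_classP/weq_rel; exists u, v.
rewrite raag_class_cons (raag_class_cons (v, _)) (raag_class_cons (u, true)).
rewrite !raag_class_letter => h; rewrite /commute.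
by move/(congr1 (fun x => gen v * (gen u * x))): h; rewrite mulg1 !mulVKg => ->.
Qed.

(** Cancelling pairs and relators have even length, so the parity of the length of a word depends
    only on its class. *)
Lemma raag_gen_neq1 v : gen v != 1.
Proof.
suff odd_weq u w : weq u w -> odd (size u) = odd (size w).
  by apply/eqP => /raag_classP /odd_weq.
elim=> {u w} [//|u w _ -> //|u v' w _ -> _ -> //|u u' w w' _ hu _ hw|//|].
  by rewrite !size_cat !oddD hu hw.
by move=> r [x [y [_ ->]]].
Qed.

(** The endomorphism killing the generators outside [V]. The choice of representative is harmless
    because deleting letters respects [weq]. *)
Definition retract (V : pred T) (x : A) : A :=
  raag_class [seq l <- repr x | V l.1].

Section Retract.
Variable V : pred T.

(** Deleting one of the two generators from a commutator leaves a cancelling pair. *)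
Lemma weq_filter u w :
  weq u w -> weq [seq l <- u | V l.1] [seq l <- w | V l.1].
Proof.
elim=> {u w}
  [w|u w _|u v w _ uv _|u u' w w' _ uu' _ ww'|x b|r [x [y [exy ->]]]].
- exact: weq_refl.
- exact: weq_sym.
- exact: weq_trans.
- by rewrite !filter_cat; apply: weq_cat.
- by rewrite /=; case: (V x); [exact: weq_cancel | exact: weq_refl].
- rewrite /=; case: (V x); case: (V y).
  + by apply: weq_rel; exists x, y.
  + exact: (weq_cancel _ x false).
  + exact: (weq_cancel _ y false).
  + exact: weq_refl.
Qed.

Lemma retract_class w :
  retract V (raag_class w) = raag_class [seq l <- w | V l.1].
Proof.
by apply/raag_classP/weq_filter; apply/raag_classP; rewrite raag_class_repr.
Qed.

Lemma retractM x y : retract V (x * y) = retract V x * retract V y.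
Proof.
rewrite -[x]raag_class_repr -[y]raag_class_repr -raag_class_cat !retract_class.
by rewrite filter_cat raag_class_cat.
Qed.

Lemma retract1 : retract V 1 = 1.
Proof. by rewrite -raag_class_nil retract_class. Qed.

Lemma retractV x : retract V x^-1 = (retract V x)^-1.
Proof. by symmetry; apply: mulg1_eq; rewrite -retractM mulgV retract1. Qed.

Lemma retractJ x y : retract V (x ^ y) = retract V x ^ retract V y.
Proof. by rewrite !conjgE !retractM retractV. Qed.

Lemma retract_gen v : retract V (gen v) = if V v then gen v else 1.
Proof.
by rewrite -[gen v]/(raag_class [:: (v, true)]) retract_class /=; case: (V v).
Qed.

End Retract.

Lemma retract_comp (V W : pred T) x :
  retract V (retract W x) = retract (predI V W) x.
Proof. by rewrite -[x]raag_class_repr !retract_class filter_predI. Qed.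

Lemma eq_retract (V W : pred T) (x : A) : V =1 W -> retract V x = retract W x.
Proof. by move=> VW; congr raag_class; apply: eq_filter => l; apply: VW. Qed.

(** Retracting onto [u] alone keeps [gen u], which is nontrivial, and kills every other
    generator. *)
Lemma raag_gen_inj : injective gen.
Proof.
move=> u v /(congr1 (retract (pred1 u))); rewrite !retract_gen /= eqxx.
by case: eqP => // _ /eqP; rewrite (negPf (raag_gen_neq1 u)).
Qed.

End Presentation.

(** * Subgroups generated by vertices, and actions given letter by letter *)

Section GeneratedSubgroups.
Variables (T : finType) (e : rel T).
Local Open Scope group_scope.

Local Notation A := (raag e).
Local Notation gen := (raag_gen e).
Local Notation weq := (weq (raag_rel e)).

Definition gen_by (V : pred T) (x : A) : Prop :=
  exists2 w : word T, all (fun l => V l.1) w & x = raag_class e w.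

Lemma gen_by1 V : gen_by V 1.
Proof. by exists [::]. Qed.

Lemma gen_byM V x y : gen_by V x -> gen_by V y -> gen_by V (x * y).
Proof.
move=> [u uV ->] [w wV ->]; exists (u ++ w); last by rewrite raag_class_cat.
by rewrite all_cat uV.
Qed.

Lemma gen_byV V x : gen_by V x -> gen_by V x^-1.
Proof.
move=> [u uV ->]; exists (winv u); last by rewrite raag_class_winv.
by rewrite /winv all_rev all_map.
Qed.

Lemma gen_byVE V x : gen_by V x^-1 <-> gen_by V x.
Proof. by split=> /gen_byV //; rewrite invgK. Qed.

Lemma gen_by_gen (V : pred T) v : V v -> gen_by V (gen v).
Proof. by move=> Vv; exists [:: (v, true)] => //=; rewrite Vv. Qed.

Lemma gen_byS (V W : pred T) x : {subset V <= W} -> gen_by V x -> gen_by W x.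
Proof. by move=> VW [w wV ->]; exists w => //; apply: sub_all wV => l /VW. Qed.

Lemma gen_byMl V x y : gen_by V x -> gen_by V (x * y) <-> gen_by V y.
Proof.
move=> Vx; split=> [Vxy|]; last exact: gen_byM.
by rewrite -(mulKg x y); apply: gen_byM Vxy; apply: gen_byV.
Qed.

Lemma gen_by_retract V x : gen_by V (retract V x).
Proof. by exists [seq l <- repr x | V l.1] => //; apply: filter_all. Qed.

Lemma retract_id V x : gen_by V x -> retract V x = x.
Proof.
by move=> [w wV ->]; rewrite retract_class; congr raag_class; apply/all_filterP.
Qed.

Lemma retract_gen_by (V W : pred T) x :
  gen_by V x -> gen_by (predI W V) (retract W x).
Proof. by move=> /retract_id <-; rewrite retract_comp; apply: gen_by_retract. Qed.

Lemma gen_by_commute (V : pred T) x y :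
  (forall v, V v -> commute y (gen v)) -> gen_by V x -> commute y x.
Proof.
move=> cV [w + ->]; elim: w => [_|[v b] w IH /= /andP[Vv wV]].
  exact: commute1.
rewrite raag_class_cons raag_class_letter.
apply: commuteM (IH wV); case: b; first exact: cV.
by apply: commuteV; apply: cV.
Qed.

Section Action.
Variables (S : Type) (P : S -> Prop) (F : T * bool -> S -> S).
Hypothesis F_inv : forall l s, P s -> P (F l s).
Hypothesis F_cancel : forall v b s, P s -> F (v, b) (F (v, ~~ b) s) = s.
Hypothesis F_comm : forall u v s, e u v -> P s ->
  F (u, true) (F (v, true) s) = F (v, true) (F (u, true) s).

(** A left action: the last letter of a word acts first. It is well defined on the states satisfying
    [P], where the letters obey the defining relations. *)
Definition raag_act (x : A) (s : S) : S := foldr F s (repr x).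

Lemma foldr_inv w s : P s -> P (foldr F s w).
Proof. by move=> Ps; elim: w => //= l w IH; apply: F_inv. Qed.

Lemma weq_foldr u w : weq u w -> forall s, P s -> foldr F s u = foldr F s w.
Proof.
elim=> {u w} [//|u w _ h s Ps|u v w _ h1 _ h2 s Ps|u u' w w' _ h1 _ h2 s Ps
  |v b s Ps|r].
- by rewrite h.
- by rewrite h1 ?h2.
- by rewrite !foldr_cat h2 // h1 //; apply: foldr_inv.
- exact: F_cancel.
(* Swapping the last two letters of u^-1 v^-1 u v produces two nested cancelling pairs. *)
move=> [u [v [euv ->]]] s Ps /=; rewrite (F_comm euv) //.
have Pu : P (F (u, true) s) by apply: F_inv.
by rewrite (F_cancel v false Pu) (F_cancel u false).
Qed.

Lemma raag_act_class w s : P s -> raag_act (raag_class e w) s = foldr F s w.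
Proof.
by move=> Ps; apply: weq_foldr => //; apply/raag_classP; rewrite raag_class_repr.
Qed.

Lemma raag_act_inv x s : P s -> P (raag_act x s).
Proof. exact: foldr_inv. Qed.

Lemma raag_act1 s : P s -> raag_act 1 s = s.
Proof. by move=> Ps; rewrite -raag_class_nil raag_act_class. Qed.

Lemma raag_actM x y s : P s -> raag_act (x * y) s = raag_act x (raag_act y s).
Proof.
move=> Ps; rewrite -[x]raag_class_repr -[y]raag_class_repr -raag_class_cat.
rewrite !raag_act_class ?foldr_cat //; exact: foldr_inv.
Qed.

Lemma raag_act_gen v s : P s -> raag_act (gen v) s = F (v, true) s.
Proof.
by move=> Ps; rewrite -[gen v]/(raag_class e [:: (v, true)]) raag_act_class.
Qed.

Lemma raag_actK x s : P s -> raag_act x^-1 (raag_act x s) = s.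
Proof. by move=> Ps; rewrite -raag_actM // mulVg raag_act1. Qed.

End Action.

(** * A test action for commuting with a generator *)

Section CosetAction.
Hypotheses (e_sym : symmetric e) (e_irr : irreflexive e).
Variables (w : T) (k : A).

Local Notation H := (gen_by (e w)).

(* The letter [w] acts on the fibre over [g] only: with the single fixed point 0
   over H and without fixed point over Hk. Whatever commutes with [w] preserves
   the set of fixed points of [w], and [k] is a parameter of this test. *)
Definition coset_fiber (g : A) (b : bool) (n : int) : int :=
  if `[< H g >] then - n
  else if `[< H (g * k^-1) >] then (if b then n + 1 else n - 1) else n.

Definition coset_step (l : T * bool) (s : A * int) : A * int :=
  if l.1 == w then (s.1, coset_fiber s.1 l.2 s.2)
  else (raag_class e [:: l] * s.1, s.2).

Local Notation act := (raag_act coset_step).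

(** The fibre map depends only on the coset Hg, so translation by a neighbour of [w] commutes with
    [w]. *)
Lemma coset_fiberM h g b n : H h -> coset_fiber (h * g) b n = coset_fiber g b n.
Proof.
move=> Hh; rewrite /coset_fiber -mulgA.
by rewrite !(asbool_equiv_eq (gen_byMl _ Hh)).
Qed.

Lemma coset_cancel v b s :
  True -> coset_step (v, b) (coset_step (v, ~~ b) s) = s.
Proof.
move=> _; case: s => g n; rewrite /coset_step /=; case: eqVneq => _ /=.
  congr (_, _); rewrite /coset_fiber; case: `[< H g >]; first by rewrite opprK.
  by case: `[< H (g / k) >] => //; case: b => /=; rewrite ?addrK ?subrK.
rewrite mulgA -raag_class_cat /= [raag_class _ _](_ : _ = 1) ?mul1g //.
by rewrite -raag_class_nil; apply/raag_classP/weq_cancel.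
Qed.

Lemma coset_comm u v s : e u v -> True ->
  coset_step (u, true) (coset_step (v, true) s)
    = coset_step (v, true) (coset_step (u, true) s).
Proof.
move=> euv _; case: s => g n; rewrite /coset_step /=.
case: (eqVneq u w) (eqVneq v w) => [uw|uw] [vw|vw] /=.
- by rewrite uw vw e_irr in euv.
- by congr (_, _); rewrite coset_fiberM //; apply: gen_by_gen; rewrite -uw.
- congr (_, _); rewrite coset_fiberM //; apply: gen_by_gen.
  by rewrite e_sym -vw.
- congr (_, _); rewrite !mulgA -[raag_class _ _]/(gen u).
  rewrite -[raag_class _ [:: (v, _)]]/(gen v).
  by rewrite (raag_gen_commute euv).
Qed.

Lemma coset_actM x y s : act (x * y) s = act x (act y s).
Proof. by rewrite (raag_actM (P := fun=> True) _ coset_cancel coset_comm). Qed.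

Lemma coset_actK x s : act x^-1 (act x s) = s.
Proof. by rewrite (raag_actK (P := fun=> True) _ coset_cancel coset_comm). Qed.

Lemma coset_act_gen v s : act (gen v) s = coset_step (v, true) s.
Proof. by rewrite (raag_act_gen (P := fun=> True) _ coset_cancel coset_comm). Qed.

(** As [w] leaves the base coordinate alone, that coordinate sees only the image of [x] after
    killing [w]. *)
Lemma coset_act1 x s : (act x s).1 = retract (predC1 w) x * s.1.
Proof.
rewrite -[x]raag_class_repr retract_class.
rewrite (raag_act_class (P := fun=> True) _ coset_cancel coset_comm) //.
elim: (repr x) => [|[v b] u IH] /=; first by rewrite raag_class_nil mul1g.
move: IH; set r := foldr _ _ _ => IH.
rewrite /coset_step /=; case: eqVneq => _ //=.
by rewrite [in RHS]raag_class_cons -mulgA; congr (_ * _).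
Qed.

Lemma coset_fixed y s : commute y (gen w) ->
  act (gen w) s = s -> act (gen w) (act y s) = act y s.
Proof. by move=> cyw ws; rewrite -coset_actM -cyw coset_actM ws. Qed.

End CosetAction.

(** * Centralizers of generators *)

Section Centralizer.
Hypotheses (e_sym : symmetric e) (e_irr : irreflexive e).

(** Take [k] = 1, so that [w] negates the fibre over H and is the identity elsewhere. If the image
    of [y] were outside H, then [w] would fix y(1, 1), hence also (1, 1), which it sends to (1,
    -1). *)
Lemma commute_gen_retract w y :
  commute y (gen w) -> gen_by (e w) (retract (predC1 w) y).
Proof.
move=> cyw; apply: contrapT => nH.
set s := raag_act (coset_step w 1) y (1, 1%R : int).
have [y1 y2] : s.1 = retract (predC1 w) y /\ commute y^-1 (gen w).
  split; first by rewrite coset_act1 // mulg1.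
  by apply/commute_sym/commuteV/commute_sym.
have sw : raag_act (coset_step w 1) (gen w) s = s.
  rewrite coset_act_gen // /coset_step /= eqxx [s in RHS]surjective_pairing.
  by rewrite /coset_fiber y1 invg1 mulg1 asboolF.
have := coset_fixed e_sym e_irr y2 sw; rewrite coset_actK //.
rewrite coset_act_gen // /coset_step /= eqxx /coset_fiber asboolT //.
exact: gen_by1.
Qed.

(** The conjugate w^h preserves the fixed points of [w] and the base coordinate. Since (1, 0) is the
    only fixed point of [w] over 1, w^h fixes it, so [w] fixes h(1, 0), which lies over [k]. If [k]
    were outside H, then [w] would be a shift there. *)
Lemma commute_conj_gen_retract w h :
  commute (gen w ^ h) (gen w) -> gen_by (e w) (retract (predC1 w) h).
Proof.
move=> cyw; apply: contrapT; set k := retract (predC1 w) h => nH.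
pose act := raag_act (coset_step w k).
have H1 : gen_by (e w) 1 by exact: gen_by1.
have w1 m : act (gen w) (1, m) = (1, (- m)%R).
  by rewrite /act coset_act_gen // /coset_step /= eqxx /coset_fiber asboolT.
have fix1 : act (gen w) (1, 0%R) = (1, 0%R) by rewrite w1 oppr0.
have := coset_fixed e_sym e_irr cyw fix1; rewrite -/act.
have: (act (gen w ^ h) (1, 0%R)).1 = 1.
  by rewrite /act coset_act1 // retractJ retract_gen /= eqxx conj1g mulg1.
case Es: (act _ _) => [g m] /= g1; rewrite g1 w1 => -[] mm.
have m0 : m = 0%R by apply/eqP; rewrite -eqNr mm.
move: Es; rewrite g1 m0 => /(congr1 (act h)).
rewrite /act -coset_actM // conjgE mulVKg coset_actM // -/act.
have: (act h (1, 0%R)).1 = k by rewrite /act coset_act1 // mulg1.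
case: (act h _) => [k' n] /= ->; rewrite /act coset_act_gen // /coset_step /= eqxx.
rewrite /coset_fiber asboolF // mulgV asboolT // => -[] /eqP.
by rewrite -subr_eq0 addrAC subrr add0r oner_eq0.
Qed.

End Centralizer.
End GeneratedSubgroups.

(** * Normal forms in the free group on two nonadjacent vertices *)

Section FreeSubgroup.
Variables (T : finType) (e : rel T).
Local Open Scope group_scope.

Local Notation A := (raag e).
Local Notation gen := (raag_gen e).

Section FreeProduct.
Variables (a b : T).
Hypotheses (e_sym : symmetric e) (ab_neq : a != b) (ab_nadj : ~~ e a b).

Definition side (x : bool) : T := if x then a else b.

Local Notation syllable := (bool * A)%type.

Definition is_syllable (p : syllable) : bool :=
  `[< gen_by (pred1 (side p.1)) p.2 >].

Definition syl_prod (s : seq syllable) : A := foldr (fun p x => p.2 * x) 1 s.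

Definition syl_inv (s : seq syllable) : seq syllable :=
  rev [seq (p.1, p.2^-1) | p <- s].

Definition reduced (s : seq syllable) : bool :=
  all (fun p => is_syllable p && (p.2 != 1)) s &&
  sorted (fun x y : bool => x != y) (unzip1 s).

(** Left multiplication by a syllable, carried out on normal forms. *)
Definition push (p : syllable) (s : seq syllable) : seq syllable :=
  if p.2 == 1 then s else
  if s is q :: s' then
    if q.1 == p.1 then
      if p.2 * q.2 == 1 then s' else (p.1, p.2 * q.2) :: s'
    else p :: s
  else [:: p].

(** Ignoring the other letters builds the retraction onto [a] and [b] into the action. *)
Definition push_letter (l : T * bool) (s : seq syllable) : seq syllable :=
  if l.1 == a then push (true, raag_class e [:: l]) s
  else if l.1 == b then push (false, raag_class e [:: l]) s else s.

Local Notation act := (@raag_act T e _ push_letter).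

Lemma syl_prod_cat s t : syl_prod (s ++ t) = syl_prod s * syl_prod t.
Proof. by elim: s => [|p s IH] /=; rewrite ?mul1g // IH mulgA. Qed.

Lemma syl_prod_inv s : syl_prod (syl_inv s) = (syl_prod s)^-1.
Proof.
rewrite /syl_inv; elim: s => [|p s IH] /=; first by rewrite invg1.
by rewrite rev_cons -cats1 syl_prod_cat IH /= mulg1 invgM.
Qed.

Lemma is_syllableV p : is_syllable (p.1, p.2^-1) = is_syllable p.
Proof. exact: (asbool_equiv_eq (gen_byVE _ _)). Qed.

Lemma all_syllable_inv s : all is_syllable (syl_inv s) = all is_syllable s.
Proof.
by rewrite /syl_inv all_rev all_map; apply: eq_all => p /=; apply: is_syllableV.
Qed.

Lemma reduced_syllable s : reduced s -> all is_syllable s.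
Proof. by case/andP=> h _; apply: sub_all h => p /andP[]. Qed.

Lemma reduced_cons p s : reduced (p :: s) =
  [&& is_syllable p, p.2 != 1, path (fun x y => x != y) p.1 (unzip1 s)
    & reduced s].
Proof.
rewrite /reduced /=; apply/idP/idP.
  by move=> /andP[/andP[/andP[-> ->] ->] h] /=; rewrite h (path_sorted h).
by move=> /and4P[-> -> -> /andP[-> _]].
Qed.

Lemma push_reduced p s : is_syllable p -> reduced s -> reduced (push p s).
Proof.
move=> psyl; rewrite /push; case: eqP => [//|/eqP p1].
case: s => [_|q s rs].
  by rewrite /reduced /= psyl p1.
have := rs; rewrite reduced_cons => /and4P[qsyl q1 qs rs'].
case: eqP => [qp|/eqP qp]; last first.
  by rewrite reduced_cons psyl p1 rs /= (eq_sym p.1) qp qs.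
case: eqP => // /eqP pq; rewrite reduced_cons pq rs' -qp qs !andbT /=.
apply/asboolP; apply: gen_byM; last exact/asboolP.
by rewrite qp; apply/asboolP.
Qed.

(** The delicate case is when [q] cancels the head of [s]: since [s] is reduced, the next syllable
    lies on the other side, so [p] does not merge with it. *)
Lemma pushM x p q s :
  reduced s -> push (x, p) (push (x, q) s) = push (x, p * q) s.
Proof.
rewrite {2}/push /=; case: (eqVneq q 1) => [-> _|q1]; first by rewrite mulg1.
case: s => [_|[y r] s].
  rewrite /push /= eqxx.
  by case: (eqVneq p 1) => [->|//]; rewrite mul1g (negPf q1).
rewrite reduced_cons /= => /and4P[_ r1 ys _].
case: (eqVneq y x) => [yx|yx]; last first.
  rewrite /push /= eqxx (negPf yx).
  by case: (eqVneq p 1) => [->|//]; rewrite mul1g (negPf q1).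
rewrite yx in ys *; case: (eqVneq (q * r) 1) => [qr|qr].
  have pqr : p * q * r = p by rewrite -mulgA qr mulg1.
  rewrite /push /= eqxx pqr.
  case: (eqVneq p 1) => [->|p1].
    by rewrite mul1g (negPf q1).
  case: (eqVneq (p * q) 1) => [pq|pq].
    have <- : p = r by rewrite -pqr pq mul1g.
    by case: s ys => [//|[z t] s] /= /andP[]; rewrite eq_sym => /negPf ->.
  by case: s ys => [//|[z t] s] /= /andP[]; rewrite eq_sym => /negPf ->.
rewrite /push /= eqxx mulgA.
case: (eqVneq p 1) => [->|p1]; first by rewrite mul1g (negPf q1) (negPf qr).
by case: (eqVneq (p * q) 1) => [->|//]; rewrite mul1g (negPf r1).
Qed.

Lemma push1 x s : push (x, 1) s = s.
Proof. by rewrite /push eqxx. Qed.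

Lemma syl_prod_push p s : syl_prod (push p s) = p.2 * syl_prod s.
Proof.
rewrite /push; case: eqP => [->|_]; first by rewrite mul1g.
case: s => [//|q s]; case: eqP => // _; rewrite /= mulgA.
by case: eqP => // ->; rewrite mul1g.
Qed.

Lemma size_push p s : (size (push p s) <= (size s).+1)%N.
Proof.
rewrite /push; case: eqP => // _; case: s => // q s.
by case: eqP => // _; case: eqP => //= _; apply: ltnW.
Qed.

Lemma push_letterE x i s :
  push_letter (side x, i) s = push (x, raag_class e [:: (side x, i)]) s.
Proof.
by rewrite /push_letter /=; case: x; rewrite /= eqxx // eq_sym (negPf ab_neq).
Qed.

Lemma push_letter_out v i s : ~~ pred2 a b v -> push_letter (v, i) s = s.
Proof. by rewrite /push_letter /= negb_or => /andP[/negPf -> /negPf ->]. Qed.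

Lemma pred2_side v : pred2 a b v -> exists x, v = side x.
Proof. by case/orP=> /eqP ->; [exists true | exists false]. Qed.

Lemma letter_syllable x i : is_syllable (x, raag_class e [:: (side x, i)]).
Proof. by apply/asboolP; exists [:: (side x, i)] => //=; rewrite eqxx. Qed.

Lemma push_letter_inv l s : reduced s -> reduced (push_letter l s).
Proof.
case: l => v i; have [/pred2_side[x ->]|out] := boolP (pred2 a b v).
  by rewrite push_letterE; apply/push_reduced/letter_syllable.
by rewrite push_letter_out.
Qed.

Lemma push_letter_cancel v i s :
  reduced s -> push_letter (v, i) (push_letter (v, ~~ i) s) = s.
Proof.
have [/pred2_side[x ->] rs|out _] := boolP (pred2 a b v).
  rewrite !push_letterE pushM // -raag_class_cat /=.
  rewrite [raag_class _ _](_ : _ = 1) ?push1 //.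
  by rewrite -raag_class_nil; apply/raag_classP/weq_cancel.
by rewrite !push_letter_out.
Qed.

(** As [a] and [b] are not adjacent, one end of an edge acts trivially or both ends are the same
    letter. *)
Lemma push_letter_comm u v s : e u v -> reduced s ->
  push_letter (u, true) (push_letter (v, true) s)
    = push_letter (v, true) (push_letter (u, true) s).
Proof.
move=> euv _.
have [/pred2_side[x ux]|out] := boolP (pred2 a b u); last first.
  by rewrite !(push_letter_out _ _ out).
have [/pred2_side[y vy]|out] := boolP (pred2 a b v); last first.
  by rewrite !(push_letter_out _ _ out).
have [xy|] := eqVneq x y; first by rewrite ux vy xy.
move: euv; rewrite ux vy; case: x y {ux vy} => -[] //=.
  by rewrite (negPf ab_nadj).
by rewrite e_sym (negPf ab_nadj).
Qed.

Lemma syl_act_inv x s : reduced s -> reduced (act x s).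
Proof. exact: (raag_act_inv (P := reduced) push_letter_inv). Qed.

Lemma syl_actM x y s : reduced s -> act (x * y) s = act x (act y s).
Proof.
apply: (raag_actM (P := reduced) push_letter_inv push_letter_cancel).
exact: push_letter_comm.
Qed.

Lemma syl_act1 s : reduced s -> act 1 s = s.
Proof.
apply: (raag_act1 (P := reduced) push_letter_inv push_letter_cancel).
exact: push_letter_comm.
Qed.

Lemma syl_act_class w s :
  reduced s -> act (raag_class e w) s = foldr push_letter s w.
Proof.
apply: (raag_act_class (P := reduced) push_letter_inv push_letter_cancel).
exact: push_letter_comm.
Qed.

Lemma syl_act_syllable p s : is_syllable p -> reduced s -> act p.2 s = push p s.
Proof.
case: p => x g /asboolP /= [w wx ->] rs; rewrite syl_act_class //.
elim: w wx => [_|[v i] w IH /= /andP[/eqP -> wx]] /=; first by rewrite push1.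
by rewrite IH // push_letterE pushM // -raag_class_cons.
Qed.

(** Uniqueness of normal forms: acting on the empty sequence rebuilds [s] syllable by syllable,
    since neighbours on different sides never merge. *)
Lemma syl_act_prod s : reduced s -> act (syl_prod s) [::] = s.
Proof.
elim: s => [_|p s IH]; first by rewrite syl_act1.
rewrite reduced_cons /= => /and4P[psyl p1 ps rs].
rewrite syl_actM // IH // syl_act_syllable // /push (negPf p1).
by case: s ps {IH rs} => //= q s /andP[]; rewrite eq_sym => /negPf ->.
Qed.

(** Each syllable lengthens a normal form by at most one, so any factorization into syllables,
    reduced or not, bounds the length of the normal form. *)
Lemma size_syl_act_prod s t :
  all is_syllable s -> reduced t ->
  (size (act (syl_prod s) t) <= size s + size t)%N.
Proof.
move=> + rt; elim: s => [_|p s IH /= /andP[psyl ssyl]]; first by rewrite syl_act1.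
rewrite syl_actM // syl_act_syllable //; last exact: syl_act_inv.
by apply: leq_trans (size_push _ _) _; rewrite addSn ltnS IH.
Qed.

Lemma retract_syl_prod h :
  exists2 s, reduced s & retract (pred2 a b) h = syl_prod s.
Proof.
have [w + ->] := gen_by_retract (pred2 a b) h.
move=> wab; exists (foldr push_letter [::] w).
  by apply: (foldr_inv (P := reduced)) => //; exact: push_letter_inv.
elim: w wab => [//|[v i] w IH /= /andP[/pred2_side[x ->] wab]].
by rewrite push_letterE syl_prod_push raag_class_cons IH.
Qed.

(* Stripping powers of [side x] on the left and of [side y] on the right
   leaves a reduced word [r], and [r^-1 (side x) r (side y)] is reduced too,
   so that it cannot start with [side y] unless [r] is empty. *)
Lemma free_conj_commute x y h :
  commute (gen (side x) ^ retract (pred2 a b) h) (gen (side y)) ->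
  exists p q, [/\ gen_by (pred1 (side x)) p, gen_by (pred1 (side y)) q
    & retract (pred2 a b) h = p * q].
Proof.
have [s rs ->] := retract_syl_prod h.
have [p [r [psyl rr xr ->]]] : exists p r, [/\ gen_by (pred1 (side x)) p,
    reduced r, path (fun x y => x != y) x (unzip1 r)
    & syl_prod s = p * syl_prod r].
  case: s rs => [_|p s].
    by exists 1, [::]; split=> //; [exact: gen_by1 | rewrite mulg1].
  rewrite reduced_cons => /and4P[psyl p1 ps rs].
  case: (eqVneq p.1 x) => px.
    by exists p.2, s; rewrite -px; split=> //; apply/asboolP.
  exists 1, (p :: s); split; [exact: gen_by1| | |by rewrite mul1g].
    by rewrite reduced_cons psyl p1 ps.
  by rewrite /= eq_sym px.
(* The default [~~ y] makes the condition on the last side hold when [t] is empty. *)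
have {rr xr s rs} [t [q [qsyl rt xt yt ->]]] : exists t q,
    [/\ gen_by (pred1 (side y)) q, reduced t,
    path (fun x y => x != y) x (unzip1 t),
    last (~~ y) (unzip1 t) != y & syl_prod r = syl_prod t * q].
  case/lastP: r rr xr => [_ _|r q].
    exists [::], 1; split=> //; [exact: gen_by1 | by case: y | by rewrite mulg1].
  rewrite /reduced /unzip1 map_rcons all_rcons rcons_path.
  move=> /andP[/andP[/andP[qsyl q1] rsyl] srt] /andP[xr rq].
  case: (eqVneq q.1 y) => qy.
    exists r, q.2; split=> //.
    - by rewrite -qy; apply/asboolP.
    - by rewrite rsyl (path_sorted xr).
    - rewrite -/(unzip1 r) in xr rq *.
      by case: (unzip1 r) rq => [|z u]; rewrite /= -qy //; case: (q.1).
    - by rewrite -cats1 syl_prod_cat /= mulg1.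
  exists (rcons r q), 1; split; rewrite ?mulg1 //; first exact: gen_by1.
  - by rewrite all_rcons qsyl q1 rsyl /unzip1 map_rcons.
  - by rewrite /unzip1 map_rcons rcons_path xr rq.
  - by rewrite /unzip1 map_rcons last_rcons.
have cxp : commute (gen (side x)) p.
  by apply: (gen_by_commute _ psyl) => v /eqP ->.
have cyq : commute (gen (side y)) q.
  by apply: (gen_by_commute _ qsyl) => v /eqP ->.
(* Since [p] commutes with [gen (side x)] and [q] with [gen (side y)], both can be stripped off and
   only [t] remains. *)
rewrite conjgM [_ ^ p]conjgE cxp mulKg conjgM => ct.
have {}ct : commute (gen (side x) ^ syl_prod t) (gen (side y)).
  move/(congr1 (conjg^~ q^-1)): ct => /=; rewrite conjMg [RHS]conjMg conjgK.
  by rewrite [gen (side y) ^ _]conjgE (commuteV cyq) mulKg.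
case: (eqVneq t [::]) => [->|t0]; first by exists p, q; split=> //; rewrite mul1g.
pose cx : syllable := (x, gen (side x)).
pose cy : syllable := (y, gen (side y)).
have okgen z : is_syllable (z, gen (side z)) && (gen (side z) != 1).
  by rewrite raag_gen_neq1 andbT (letter_syllable z true).
have tsyl : all (fun p => is_syllable p && (p.2 != 1)) t by case/andP: rt.
have itsyl : all (fun p => is_syllable p && (p.2 != 1)) (syl_inv t).
  rewrite /syl_inv all_rev all_map; apply: sub_all tsyl => z /=.
  by rewrite is_syllableV invg_eq1.
have tinv : unzip1 (syl_inv t) = rev (unzip1 t).
  by rewrite /syl_inv /unzip1 map_rev -map_comp.
have rev_alt z s' : sorted (fun x y : bool => x != y) (rcons (rev s') z)
    = path (fun x y : bool => x != y) z s'.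
  by rewrite -rev_cons rev_sorted; apply: eq_path => i j; rewrite eq_sym.
set u := unzip1 t in xt yt tinv.
have u0 : u != [::] by rewrite -size_eq0 size_map size_eq0.
have xu : last x u != y by case: (u) u0 yt.
have r1 : reduced (syl_inv t ++ cx :: t ++ [:: cy]).
  rewrite /reduced all_cat itsyl /= all_cat tsyl /= !okgen /=.
  rewrite {1}/unzip1 map_cat /= map_cat -!/(unzip1 _) tinv -/u /=.
  by rewrite sorted_cat_cons rev_alt xt /= cat_path xt /= xu.
have r2 : reduced (cy :: syl_inv t ++ cx :: t).
  rewrite /reduced /= all_cat itsyl /= tsyl !okgen /=.
  rewrite {1}/unzip1 map_cat /= -!/(unzip1 _) tinv -/u cat_path /=.
  rewrite xt andbT.
  have : sorted (fun x y : bool => x != y) (rev (rcons u y)).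
    rewrite rev_sorted; case: (u) u0 xt xu => [//|z v] _ /= /andP[_ zv] zvy.
    rewrite rcons_path (eq_path (e' := fun x y => x != y)) ?zv 1?eq_sym //.
    by move=> i j; rewrite eq_sym.
  rewrite rev_rcons /= => ->.
  by case: (u) u0 xt => //= z v _ /andP[]; rewrite rev_cons last_rcons eq_sym.
have := syl_act_prod r2; have := syl_act_prod r1.
rewrite /= !syl_prod_cat /= syl_prod_cat /= mulg1 syl_prod_inv.
have -> : (syl_prod t)^-1 * (gen (side x) * (syl_prod t * gen (side y)))
    = gen (side y) * ((syl_prod t)^-1 * (gen (side x) * syl_prod t)).
  by rewrite -[RHS]ct conjgE !mulgA.
(* The two reduced words have the same product, so their lists of sides agree. One begins with the
   last side of [t], which is not [y], and the other begins with [y]. *)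
move=> -> /(congr1 unzip1); rewrite /unzip1 /= map_cat -!/(unzip1 _) tinv.
case/lastP: (u) u0 xu => [//|v z] _; rewrite last_rcons rev_rcons /= => zy [zy'].
by rewrite zy' eqxx in zy.
Qed.

End FreeProduct.
End FreeSubgroup.

(** * Lower bound: syllables along paths of the extension graph *)

Section ExtensionPaths.
Variables (T : finType) (e : rel T).
Local Open Scope group_scope.

Local Notation A := (raag e).
Local Notation gen := (raag_gen e).

Section LowerBound.
Variables (a b : T).
Hypotheses (e_sym : symmetric e) (e_irr : irreflexive e).
Hypotheses (ab_neq : a != b) (ab_nadj : ~~ e a b).
Hypothesis no_common : forall v, ~~ (e v a && e v b).

Local Notation side := (side a b).
Local Notation psi := (retract (pred2 a b)).
Local Notation is_syllable := (@is_syllable T e a b).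
Local Notation syl_prod := (@syl_prod T e).
Local Notation reduced := (@reduced T e a b).

(** These vertices generate the subgroup S_v of the overview. *)
Definition star_ab (v : T) : pred T :=
  predI (pred2 a b) (fun z => (z == v) || e v z).

Lemma psi_retract v (x : A) :
  ~~ pred2 a b v -> psi (retract (predC1 v) x) = psi x.
Proof.
move=> /= out; rewrite retract_comp; apply: eq_retract => z /=.
by case: (eqVneq z v) => [->|_] /=; rewrite ?andbT ?andbF // (negPf out).
Qed.

Lemma psi_link v (x : A) : gen_by (e v) x -> gen_by (star_ab v) (psi x).
Proof.
move=> /(retract_gen_by (pred2 a b)); apply: gen_byS => z.
by rewrite !inE /= /star_ab /= => /andP[-> ->]; rewrite orbT.
Qed.

Lemma side_star x (p : A) :
  gen_by (pred1 (side x)) p -> gen_by (star_ab (side x)) p.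
Proof.
apply: gen_byS => z /eqP ->; rewrite !inE /star_ab /= eqxx andbT.
by case: x; rewrite /= eqxx ?orbT.
Qed.

Lemma psi_gen x : psi (gen (side x)) = gen (side x).
Proof. by rewrite retract_gen; case: x; rewrite /= eqxx ?orbT. Qed.

Lemma free_conj_commute_star x y h :
  commute (gen (side x) ^ h) (gen (side y)) ->
  exists p q, [/\ gen_by (star_ab (side x)) p, gen_by (star_ab (side y)) q
    & psi h = p * q].
Proof.
move=> /(congr1 psi); rewrite retractM [RHS]retractM retractJ !psi_gen.
move=> /(free_conj_commute e_sym ab_neq ab_nadj).
move=> [p [q [/side_star px /side_star qy ->]]].
by exists p, q.
Qed.

(** If [v] is [a] or [b], this is a computation in the free group. Otherwise [psi] does not see [v],
    and after killing [v] the element [c] lies in the subgroup of the link of [v]. *)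
Lemma commute_gen_star v c : commute c (gen v) -> gen_by (star_ab v) (psi c).
Proof.
move=> cv; have [/pred2_side[x vx]|out] := boolP (pred2 a b v).
  have [|p [q [ps qs ->]]] := @free_conj_commute_star x x c; last first.
    by rewrite vx; apply: gen_byM.
  by rewrite -vx conjgE -cv mulKg; apply: commute_refl.
by rewrite -(psi_retract c out); apply/psi_link/commute_gen_retract.
Qed.

Lemma conj_commute_star_out v w h : ~~ pred2 a b w ->
  commute (gen v ^ h) (gen w) ->
  exists p q, [/\ gen_by (star_ab v) p, gen_by (star_ab w) q & psi h = p * q].
Proof.
move=> out; case: (eqVneq v w) => [->|vw].
  move=> /(commute_conj_gen_retract e_sym e_irr) /psi_link.
  rewrite psi_retract // => hs; exists 1, (psi h).
  by split=> //; [exact: gen_by1 | rewrite mul1g].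
move=> /(commute_gen_retract e_sym e_irr).
rewrite retractJ retract_gen /= vw; set k := retract _ h => vk.
(* As v^k lies in the subgroup of the link of [w], the retraction onto that subgroup fixes it. Hence
   [v] is in the link and v^k = v^k', so that k k'^-1 centralizes [v]. *)
pose k' := retract (e w) k.
have /esym := retract_id vk; rewrite retractJ retract_gen -/k'.
case: ifP => [ewv kk'|_ /eqP]; last first.
  by rewrite conj1g conjg_eq1 (negPf (raag_gen_neq1 _ _)).
have ck : commute (k * k'^-1) (gen v).
  by apply/commute_sym/commgP/conjg_fixP; rewrite conjgM kk' conjgK.
exists (psi (k * k'^-1)), (psi k'); split.
- exact: commute_gen_star.
- exact/psi_link/gen_by_retract.
- by rewrite -retractM mulgVK psi_retract.
Qed.

(** When only [w] is among [a] and [b], the roles of [v] and [w] are exchanged by passing to the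
    inverse of [h]. *)
Lemma conj_commute_star v w h : commute (gen v ^ h) (gen w) ->
  exists p q, [/\ gen_by (star_ab v) p, gen_by (star_ab w) q & psi h = p * q].
Proof.
have [/pred2_side[y wy]|] := boolP (pred2 a b w); last exact: conj_commute_star_out.
have [/pred2_side[x vx]|out] := boolP (pred2 a b v).
  by rewrite wy vx; apply: free_conj_commute_star.
move=> vw; have : commute (gen w ^ h^-1) (gen v).
  by move/(congr1 (conjg^~ h^-1)): vw => /=; rewrite conjMg [RHS]conjMg conjgK.
move=> /(conj_commute_star_out out) [p [q [pw qv hpq]]].
exists q^-1, p^-1; split; [exact: gen_byV | exact: gen_byV |].
by rewrite -invgM -hpq retractV invgK.
Qed.

(** The star of [v] cannot contain both [a] and [b]: they are distinct, not adjacent and without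
    common neighbour. *)
Lemma star_syllable v p : gen_by (star_ab v) p -> exists x, is_syllable (x, p).
Proof.
move=> p0; case: (boolP (star_ab v a)) => va.
  exists true; apply/asboolP; apply: gen_byS p0 => z; rewrite !inE /star_ab /=.
  move=> /andP[/orP[//|/eqP ->] bv]; move: va bv; rewrite /star_ab /= eqxx /=.
  case: (eqVneq a v) => [<- _|av] /=.
    by rewrite eq_sym (negPf ab_neq) (negPf ab_nadj).
  case: (eqVneq b v) => [<-|bv] /=; first by rewrite e_sym (negPf ab_nadj).
  by move=> va vb; have := no_common v; rewrite va vb.
exists false; apply/asboolP; apply: gen_byS p0 => z; rewrite !inE /star_ab /=.
by move=> /andP[/orP[/eqP ->|//] av]; move: va; rewrite /star_ab /= eqxx /= av.
Qed.

Lemma ext_vertexP (x : ext_vertex e) : exists v h, val x = gen v ^ h.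
Proof. by case: x => x /= /asboolP. Qed.

(** Keeping the first factor in S_v apart lets it merge with the factor from the preceding edge, so
    each edge costs one syllable and not two. *)
Lemma ext_path_syllables (s : seq (ext_vertex e)) x v h w k :
  path (@ext_edge T e) x s -> val x = gen v ^ h -> val (last x s) = gen w ^ k ->
  exists p t, [/\ gen_by (star_ab v) p, all is_syllable t,
    (size t <= (size s).+1)%N
    & psi (h * k^-1) = p * syl_prod t].
Proof.
have conj_commute (u z : T) (g l : A) : commute (gen u ^ g) (gen z ^ l) ->
    commute (gen u ^ (g * l^-1)) (gen z).
  by move/(congr1 (conjg^~ l^-1)) => /=; rewrite conjMg [RHS]conjMg conjgK -conjgM.
elim: s x v h => [|y s IH] x v h /=.
  (* For the empty path, v^h and w^k are the same vertex and so commute; this accounts for the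
     successor in the bound. *)
  move=> _ -> xy; have /conj_commute/conj_commute_star[p [q [pv qw ->]]] :
      commute (gen v ^ h) (gen w ^ k) by rewrite xy; apply: commute_refl.
  have [z qz] := star_syllable qw.
  by exists p, [:: (z, q)]; split=> //=; rewrite ?qz ?mulg1.
move=> /andP[/andP[_ /eqP xy] ys] xv yw.
have [u [g yu]] := ext_vertexP y.
have [p [t [pu tsyl st pt]]] := IH _ _ _ ys yu yw.
move: xy => /=; rewrite xv yu => /conj_commute/conj_commute_star[p' [q [pv qu hg]]].
(* Both [q] and [p] lie in S_u, so their product is a single syllable. *)
have [z qz] := star_syllable (gen_byM qu pu).
exists p', ((z, q * p) :: t); split=> //=; first by rewrite qz.
by rewrite -(divgKA g h) retractM hg pt !mulgA.
Qed.

(** The normal form of (ab)^-n. *)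
Definition inv_power (n : nat) : seq (bool * A) :=
  flatten (nseq n [:: (false, (gen b)^-1); (true, (gen a)^-1)]).

Lemma inv_power_prod n : syl_prod (inv_power n) = ((gen a * gen b) ^+ n)^-1.
Proof.
elim: n => [|n IH] /=; first by rewrite invg1.
by rewrite -/(inv_power n) IH expgSr !invgM mulgA.
Qed.

Lemma size_inv_power n : size (inv_power n) = n.*2.
Proof. by elim: n => //= n IH; rewrite -/(inv_power n) IH doubleS. Qed.

Lemma inv_power_reduced n : reduced (inv_power n).
Proof.
elim: n => //= n IH; rewrite -/(inv_power n) !reduced_cons IH.
rewrite !invg_eq1 !raag_gen_neq1 /=.
have syl x : is_syllable (x, (gen (side x))^-1).
  rewrite (is_syllableV _ _ (x, gen (side x))).
  exact: (letter_syllable e a b x true).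
rewrite (syl false) (syl true) !andbT /=.
by case: n IH => //= n; rewrite reduced_cons => /and4P[_ _ /= -> _].
Qed.

Lemma ext_walk_lower (x : ext_vertex e) : exists C, forall n m,
  walk_of_length (@ext_edge T e) x (ext_act x ((gen a * gen b) ^+ n)) m ->
  (n.*2 <= m + C)%N.
Proof.
have [v [h xv]] := ext_vertexP x.
have [s rs hs] := retract_syl_prod ab_neq h.
(* The constant pays for [s] and its inverse, for the factor [p], and for the extra syllable allowed
   in [t]. *)
exists (size s + size s + 2)%N => n m [pth [<- xpth lpth]].
have := ext_path_syllables (w := v) (k := h * (gen a * gen b) ^+ n) xpth xv.
rewrite lpth /= xv conjgM => /(_ erefl) [p [t [pv tsyl st]]].
rewrite invgM retractM hs retractM !retractV hs.
have -> : psi ((gen a * gen b) ^+ n) = (gen a * gen b) ^+ n.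
  apply: retract_id; elim: n {lpth} => [|n IH]; first exact: gen_by1.
  rewrite expgS; apply: gen_byM IH.
  by apply: gen_byM; apply: gen_by_gen; rewrite /= eqxx ?orbT.
rewrite -inv_power_prod => hpt.
have [z pz] := star_syllable pv.
(* The path describes psi(h) g^-n psi(h)^-1 with g = ab; undoing this conjugation adds [s] and its
   inverse at the two ends. *)
have prodE : syl_prod (inv_power n) = syl_prod (syl_inv s ++ (z, p) :: t ++ s).
  rewrite syl_prod_cat /= syl_prod_cat syl_prod_inv (mulgA p) -hpt.
  by rewrite -!mulgA mulVg mulg1 mulKg.
have := syl_act_prod e_sym ab_neq ab_nadj (inv_power_reduced n).
rewrite prodE => /(congr1 size); rewrite size_inv_power => <-.
have ssyl := reduced_syllable rs.
apply: leq_trans (size_syl_act_prod e_sym ab_neq ab_nadj _ _) _ => //.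
  by rewrite all_cat all_syllable_inv ssyl /= pz all_cat tsyl ssyl.
rewrite addn0 size_cat /= size_cat {1}/syl_inv size_rev size_map.
apply: (@leq_trans (size s + ((size pth).+1 + size s).+1)).
  by rewrite leq_add2l ltnS leq_add2r.
by rewrite addn2 addSn !addnS addnCA.
Qed.

End LowerBound.
End ExtensionPaths.

(** * Walks and distances in graphs *)

Section Walks.
Variables (V : eqType) (E : rel V).

Lemma walk0 x : walk_of_length E x x 0.
Proof. by exists [::]. Qed.

Lemma walk_edge x y : E x y -> walk_of_length E x y 1.
Proof. by move=> xy; exists [:: y]; rewrite /= xy. Qed.

Lemma walk_cat x y z m n :
  walk_of_length E x y m -> walk_of_length E y z n ->
  walk_of_length E x z (m + n).
Proof.
move=> [s [<- xs <-]] [t [<- xt <-]]; exists (s ++ t).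
by rewrite size_cat cat_path xs xt last_cat.
Qed.

Lemma walk_sym x y n :
  symmetric E -> walk_of_length E x y n -> walk_of_length E y x n.
Proof.
move=> E_sym [s [<- xs <-]]; exists (rev (belast x s)); split.
- by rewrite size_rev size_belast.
- by rewrite rev_path (eq_path (e' := E)) // => i j; rewrite E_sym.
- by case: s xs => //= y' s _; rewrite rev_cons last_rcons.
Qed.

Lemma gdist_le x y n : walk_of_length E x y n -> (gdist E x y <= n)%N.
Proof.
move=> w; rewrite /gdist.
case: pselect => [ex|[]]; last by exists n; apply/asboolP.
by case: ex_minnP => m _; apply; apply/asboolP.
Qed.

(** The given walk excludes the default value 0 of [gdist], so the distance is attained. *)
Lemma gdist_walk x y n :
  walk_of_length E x y n -> walk_of_length E x y (gdist E x y).
Proof.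
move=> w; rewrite /gdist.
case: pselect => [ex|[]]; last by exists n; apply/asboolP.
by case: ex_minnP => m /asboolP.
Qed.

End Walks.

Lemma connect_walk (T : finType) (e : rel T) x y :
  connect e x y -> exists n, walk_of_length e x y n.
Proof. by move=> /connectP[p xp ->]; exists (size p), p. Qed.

Lemma distance_three (T : finType) (e : rel T) :
  symmetric e -> connected_graph e -> (3 <= diameter e)%N ->
  exists a u w b, [/\ [/\ e a u, e u w & e w b], a != b, ~~ e a b
    & forall v, ~~ (e v a && e v b)].
Proof.
move=> e_sym e_conn diam.
have [x [y xy]] : exists x y, (3 <= gdist e x y)%N.
  apply: contrapT => no; move: diam; rewrite leqNgt ltnS => /negP; apply.
  apply/bigmax_leqP => x _; apply/bigmax_leqP => y _.
  by rewrite leqNgt; apply/negP => xy; apply: no; exists x, y.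
have [n /gdist_walk [s [ss xs sy]]] := connect_walk (e_conn x y).
rewrite -ss in xy; case: s xs sy ss xy => [|u [|w [|b s]]] //=.
move=> /and4P[xu uw wb bs] sy ss _.
(* Here [b] is the third vertex after [x] on a shortest walk to [y]; a shorter way from [x] to [b]
   would shorten that walk. A common neighbour of [x] and [b] would give such a way. *)
have far k : walk_of_length e x b k -> (3 <= k)%N.
  move=> xb; have by_y : walk_of_length e b y (size s) by exists s.
  have := gdist_le (walk_cat xb by_y).
  by rewrite -ss -[_.+3]/(3 + size s)%N leq_add2r.
exists x, u, w, b; split=> //.
- by apply/eqP => xb; have := @far 0; rewrite -xb => /(_ (walk0 _ _)).
- by apply/negP => /walk_edge /far.
- move=> v; apply/negP => /andP[]; rewrite e_sym => /walk_edge xv /walk_edge vb.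
  by have := far _ (walk_cat xv vb).
Qed.

(** * Connectedness of the extension graph and the upper bound *)

Section ExtensionGraph.
Variables (T : finType) (e : rel T).
Hypotheses (e_irr : irreflexive e) (e_conn : connected_graph e).
Local Open Scope group_scope.

Local Notation A := (raag e).
Local Notation gen := (raag_gen e).
Local Notation walk := (walk_of_length (@ext_edge T e)).

Lemma ext_edge_sym : symmetric (@ext_edge T e).
Proof. by move=> x y; rewrite /ext_edge eq_sym [_ * _ == _]eq_sym. Qed.

Lemma base_vertex_subproof v : is_ext_vertex (gen v).
Proof. by apply/asboolP; exists v, 1; rewrite conjg1. Qed.

Definition base_vertex v : ext_vertex e :=
  exist _ (gen v) (base_vertex_subproof v).

Lemma ext_actM (x : ext_vertex e) g h :
  ext_act x (g * h) = ext_act (ext_act x g) h.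
Proof. by apply: val_inj; rewrite /= conjgM. Qed.

Lemma ext_act1 (x : ext_vertex e) : ext_act x 1 = x.
Proof. by apply: val_inj; rewrite /= conjg1. Qed.

Lemma ext_act_edge (x y : ext_vertex e) g :
  ext_edge x y -> ext_edge (ext_act x g) (ext_act y g).
Proof.
move=> /andP[xy /eqP cxy]; apply/andP; split.
  apply: contraNneq xy => /(congr1 val) /= /conjg_inj xy.
  exact/eqP/val_inj.
by rewrite /= -conjMg cxy conjMg.
Qed.

Lemma ext_act_walk (x y : ext_vertex e) g n :
  walk x y n -> walk (ext_act x g) (ext_act y g) n.
Proof.
move=> [s [<- xs <-]]; exists [seq ext_act z g | z <- s]; split.
- by rewrite size_map.
- elim: s x xs => //= z s IH x /andP[xz zs].
  by rewrite ext_act_edge //=; apply: IH.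
- exact: (last_map (fun z => ext_act z g)).
Qed.

Lemma base_edge u v : e u v -> ext_edge (base_vertex u) (base_vertex v).
Proof.
move=> uv; apply/andP; split; last by apply/eqP/raag_gen_commute.
by apply: contraTneq uv => /(congr1 val) /= /raag_gen_inj ->; rewrite e_irr.
Qed.

Lemma base_act_fixed v g :
  commute (gen v) g -> ext_act (base_vertex v) g = base_vertex v.
Proof. by move=> vg; apply: val_inj; rewrite /= conjgE vg mulKg. Qed.

Lemma base_walk u v : exists n, walk (base_vertex u) (base_vertex v) n.
Proof.
have /connectP[p ue ->] := e_conn u v.
exists (size p), [seq base_vertex z | z <- p].
rewrite size_map last_map; split=> //.
elim: p u ue => //= z p IH u /andP[uz zp].
by rewrite base_edge //=; apply: IH.
Qed.

(** A letter of [c] fixes the vertex [c], so a walk from [v] to [c], followed by the translate of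
    its reverse, joins [v] to its image under that letter. *)
Lemma orbit_walk v h :
  exists n, walk (base_vertex v) (ext_act (base_vertex v) h) n.
Proof.
rewrite -[h]raag_class_repr; elim: (repr h) => [|[c i] w [n IH]].
  by exists 0%N; rewrite raag_class_nil ext_act1; apply: walk0.
have [m vc] := base_walk v c.
have cfix : ext_act (base_vertex c) (raag_class e [:: (c, i)]) = base_vertex c.
  apply: base_act_fixed; rewrite raag_class_letter.
  by case: i; [exact: commute_refl | exact/commuteV/commute_refl].
exists (n + (m + m))%N; rewrite raag_class_cons ext_actM.
apply: walk_cat IH (ext_act_walk _ _); apply: walk_cat (vc) _.
by rewrite -cfix; apply/ext_act_walk/(walk_sym (@ext_edge_sym)).
Qed.

Lemma ext_connected (x : ext_vertex e) v : exists n, walk x (base_vertex v) n.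
Proof.
have [u [h xu]] := ext_vertexP x.
have -> : x = ext_act (base_vertex u) h by apply: val_inj.
have [n uh] := orbit_walk u h; have [m uv] := base_walk u v.
by exists (n + m)%N; apply: walk_cat (walk_sym ext_edge_sym uh) uv.
Qed.

Variables a u w b : T.
Hypotheses (au : e a u) (uw : e u w) (wb : e w b).
Local Notation g := (gen a * gen b).

Lemma base_power_walk n :
  walk (base_vertex u) (ext_act (base_vertex u) (g ^+ n)) n.*2.
Proof.
elim: n => [|n IH]; first by rewrite ext_act1; apply: walk0.
rewrite expgSr ext_actM doubleS -addn2 addnC.
apply: walk_cat (ext_act_walk _ IH).
(* As [a] fixes [u], the target is u^b; as [b] fixes [w], the edge from [w] to u^b is a translate of
   the edge from [w] to [u]. *)
apply: (@walk_cat _ _ _ (base_vertex w) _ 1 1); first exact/walk_edge/base_edge.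
rewrite ext_actM (base_act_fixed (v := u)); last first.
  exact/commute_sym/raag_gen_commute.
rewrite -[base_vertex w](base_act_fixed (g := gen b)); last first.
  exact: raag_gen_commute.
by apply/walk_edge/ext_act_edge; rewrite ext_edge_sym; apply: base_edge.
Qed.

Lemma ext_walk_upper (x : ext_vertex e) : exists C, forall n,
  exists2 m, walk x (ext_act x (g ^+ n)) m & (m <= n.*2 + C)%N.
Proof.
(* The detour through [u] costs [k] steps at each end. *)
have [k xu] := ext_connected x u; exists (k + k)%N => n.
exists (k + (n.*2 + k))%N; last by rewrite addnCA.
apply: walk_cat (xu) (walk_cat (base_power_walk n) _).
exact/ext_act_walk/(walk_sym (@ext_edge_sym)).
Qed.

End ExtensionGraph.

(** * Passage to the limit *)

Lemma cvg_ratio_two (R : realType) (d : nat -> nat) (C : nat) :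
  (forall n, (d n <= n.*2 + C)%N /\ (n.*2 <= d n + C)%N) ->
  ((fun n => (d n)%:R / n%:R : R) @ \oo --> (2 : R))%classic.
Proof.
move=> dC; apply/cvgrPdist_le => eps eps0.
near=> n.
have n0 : (0 < n)%N by near: n; exists 1%N.
have nR : 0 < n%:R :> R by rewrite ltr0n.
(* The ratio differs from 2 by at most C / n, which is eventually at most [eps]. *)
have Cn : C%:R / eps <= n%:R.
  near: n; exact: nbhs_infty_ger.
have -> : 2 - (d n)%:R / n%:R = (n.*2%:R - (d n)%:R) / n%:R :> R.
  by rewrite mulrBl -muln2 natrM mulrAC divff ?mul1r // gt_eqF.
rewrite normrM normfV (gtr0_norm nR) ler_pdivrMr //.
apply: (@le_trans _ _ C%:R); last by rewrite mulrC -ler_pdivrMr.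
have [d1 d2] := dC n.
by rewrite ler_distlC lerBlDr -!natrD !ler_nat d1 d2.
Unshelve. all: by end_near.
Qed.

Theorem theorem6 (R : realType) (T : finType) (e : rel T)
    (e_sym : symmetric e) (e_irr : irreflexive e)
    (e_conn : connected_graph e) (e_diam : (3 <= diameter e)%N) :
  exists (g : raag e) (l : R), translation_length g l /\ 0 < l <= 2.
Proof.
have [a [u [w [b [[au uw wb] ab nab no_common]]]]] :=
  distance_three e_sym e_conn e_diam.
(* The translation length of ab is exactly 2; the error constants below depend on [x] but not on
   [n]. *)
exists (raag_gen e a * raag_gen e b)%g, 2; split; last by rewrite ltr0n lexx.
move=> x; have [C1 lower] := ext_walk_lower e_sym e_irr ab nab no_common x.
have [C2 upper] := ext_walk_upper e_irr e_conn au uw wb x.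
apply: (@cvg_ratio_two _ _ (maxn C1 C2)) => n.
have [m xm mC] := upper n; split.
  apply: leq_trans (gdist_le xm) (leq_trans mC _).
  by rewrite leq_add2l leq_maxr.
apply: leq_trans (lower _ _ (gdist_walk xm)) _.
by rewrite leq_add2l leq_maxl.
Qed.
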